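(* Let $D$ be any distribution over $\mathcal{X}\times\{\pm1\}$ with class-probability function $\eta$. Suppose $\bar D=\mathrm{BCN}^+(D,f_{-1},f_1,s)$, where $(f_{-1},f_1,s,\eta)$ are $\mathrm{BCN}^+$-admissible, and let $\bar\eta$ be the class-probability function of $\bar D$. Then $$(\forall x,x'\in\mathcal{X})\quad \eta(x)<\eta(x')\implies\bar\eta(x)<\bar\eta(x'),$$ so that $\eta=\phi\circ\bar\eta$ for some non-decreasing $\phi$.
   Context: $\mathcal{X}$ is an instance space. A distribution $D$ over $\mathcal{X}\times\{\pm1\}$ of a pair $(X,Y)$ is determined by its marginal $M=\mathbb{P}(X)$ and class-probability function $\eta(x)=\mathbb{P}(Y=1\mid X=x)$; $\pi=\mathbb{P}(Y=1)\in(0,1)$. Instance- and label-dependent noise: for $\rho_1,\rho_{-1}\colon\mathcal{X}\to[0,1]$, $\mathrm{ILN}(D,\rho_{-1},\rho_1)$ is the distribution of $(X,\bar Y)$ obtained by drawing $(X,Y)\sim D$ and flipping the label with probability $\rho_Y(X)$. Its marginal is $M$ and its class-probability function is $\bar\eta(x)=\mathbb{P}(\bar Y=1\mid X=x)=(1-\rho_1(x))\,\eta(x)+\rho_{-1}(x)\,(1-\eta(x))$ for all $x\in\mathcal{X}$. Standing assumption (bounded total noise): $\rho_1(x)+\rho_{-1}(x)<1$ for all $x\in\mathcal{X}$. $\mathrm{BCN}^+$ model: given $f_{\pm1}\colon\mathbb{R}\to[0,1]$ and $s\colon\mathcal{X}\to\mathbb{R}$, $\mathrm{BCN}^+(D,f_{-1},f_1,s)=\mathrm{ILN}(D,\rho_{-1},\rho_1)$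 with $\rho_y=f_y\circ s$. The tuple $(f_{-1},f_1,s,\eta)$ is $\mathrm{BCN}^+$-admissible if: (a) for all $x,x'\in\mathcal{X}$, $\eta(x)<\eta(x')\implies s(x)<s(x')$; (b) $f_{\pm1}$ are non-decreasing where $\eta\le\frac12$ and non-increasing where $\eta\ge\frac12$, i.e. for $y\in\{\pm1\}$ and all $x,x'$ with $s(x)\le s(x')$: if $\eta(x),\eta(x')\le\frac12$ then $f_y(s(x))\le f_y(s(x'))$, and if $\eta(x),\eta(x')\ge\frac12$ then $f_y(s(x))\ge f_y(s(x'))$; (c) $\Delta(z)=f_1(z)-f_{-1}(z)$ is non-increasing in $z$. *)

(* Defs.v *)
From HB Require Import structures.
From mathcomp Require Import all_boot all_order all_algebra.
From mathcomp Require Import all_classical all_reals all_analysis.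
From mathcomp Require Import measurable_realfun.

Set Implicit Arguments.
Unset Strict Implicit.
Unset Printing Implicit Defensive.

Import Order.TTheory GRing.Theory Num.Theory.
Import numFieldNormedType.Exports.

Local Open Scope classical_set_scope.
Local Open Scope ring_scope.

(* Labels in {+1, -1}: [true] stands for +1 and [false] for -1. *)
Notation label := bool.

(* A distribution of (X, Y) on X * {+1, -1}, given by the marginal of X and a
   regular conditional law of Y given X = x.  Such a conditional law always
   exists because labels are finite; fixing one makes P(Y = 1 | X = x) a
   function defined at every point x, not only up to a null set. *)
Record labeled_distribution d (X : measurableType d) (R : realType) :=
  LabeledDistribution {
  marginal : probability X R ;
  label_law : R.-pker X ~> label }.

Section labeled_distribution.
Context d (X : measurableType d) (R : realType).
Implicit Type D : labeled_distribution X R.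

Definition joint_law D : {measure set (X * label) -> \bar R} :=
  mkproduct
    (kprobability (measurable_cst (marginal D : pprobability X R) :
       measurable_fun [set: unit] _))
    (kernel.kernel_snd (label_law D)) tt.

Lemma joint_lawE D A : measurable A ->
  joint_law D A =
  (\int[marginal D]_x label_law D x [set y | A (x, y)])%E.
Proof.
move=> mA; rewrite /joint_law /= /kproduct.
apply: eq_integral => x _; rewrite kernel.intker_indicE//=.
by congr (label_law D x _); apply/seteqP; split=> y; rewrite /xsection/= inE.
Qed.

Lemma joint_law_setT D : joint_law D setT = 1%E.
Proof.
rewrite joint_lawE//.
rewrite (eq_integral (cst 1%E)); last by move=> x _; exact: prob_kernel.
by rewrite integral_cst// mul1e; exact: probability_setT.
Qed.

Definition label_prob D x : set label -> \bar R := label_law D x.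

HB.instance Definition _ D x := Measure.on (label_prob D x).

HB.instance Definition _ D x :=
  Measure_isProbability.Build _ _ _ (label_prob D x)
    (@prob_kernel _ _ _ _ _ (label_law D) x).

(* P(Y = 1 | X = x) *)
Definition class_prob D (x : X) : R := fine (label_law D x [set true]).

(* P(Y = 1) *)
Definition base_rate D : \bar R := joint_law D [set xy | xy.2 = true].

Lemma label_law_true D x : label_law D x [set true] = (class_prob D x)%:E.
Proof.
rewrite /class_prob fineK// ge0_fin_numE//.
apply: (@le_lt_trans _ _ (label_law D x setT)).
  exact: le_measure (mem_set _) (mem_set _) (@subsetT _ _).
by rewrite prob_kernel ltry.
Qed.

Lemma class_prob_bounds D x : 0 <= class_prob D x <= 1.
Proof.
rewrite -2!lee_fin -label_law_true measure_ge0/=.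
rewrite -(@prob_kernel _ _ _ _ _ (label_law D) x).
exact: le_measure (mem_set _) (mem_set _) (@subsetT _ _).
Qed.

End labeled_distribution.

Section label_noise.
Context d (X : measurableType d) (R : realType).
Variable rho : label -> X -> R.
Hypothesis mrho : forall y, measurable_fun [set: X] (rho y).

(* Probability that the observed label is +1, given the instance x and the true
   label y, when y is flipped with probability rho y x. *)
Definition observed_pos (xy : X * label) : R :=
  if xy.2 then 1 - rho true xy.1 else rho false xy.1.

Lemma measurable_observed_pos : measurable_fun [set: X * label] observed_pos.
Proof.
apply: measurable_fun_ifT => /=; first exact: measurable_snd.
- apply: measurable_funB => /=; first exact: measurable_cst.
  exact: measurableT_comp (mrho true) measurable_fst.
- exact: measurableT_comp (mrho false) measurable_fst.
Qed.

Definition flip_kernel : R.-pker (X * label) ~> label :=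
  kprobability (measurableT_comp measurable_bernoulli_prob
                                 measurable_observed_pos).

Variable D : labeled_distribution X R.

(* Given X = x: draw Y from label_law D x, then pass it through the flip. *)
Definition noisy_label_law : X -> {measure set label -> \bar R} :=
  mkcomp (label_law D) flip_kernel.

HB.instance Definition _ := Kernel.on noisy_label_law.

Let noisy_label_law_prob x : noisy_label_law x [set: label] = 1%E.
Proof.
rewrite /noisy_label_law /= /kcomp.
under eq_integral do rewrite prob_kernel.
by rewrite integral_cst// mul1e prob_kernel.
Qed.

HB.instance Definition _ :=
  Kernel_isProbability.Build _ _ _ _ _ noisy_label_law noisy_label_law_prob.

Definition ILN : labeled_distribution X R :=
  LabeledDistribution (marginal D) noisy_label_law.

End label_noise.

Lemma class_prob_ILN d (X : measurableType d) (R : realType)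
    (rho : label -> X -> R) (mrho : forall y, measurable_fun [set: X] (rho y))
    (D : labeled_distribution X R) (x : X) :
  (forall y, 0 <= rho y x <= 1) ->
  class_prob (ILN mrho D) x =
  (1 - rho true x) * class_prob D x + rho false x * (1 - class_prob D x).
Proof.
move=> rho01; set e := class_prob D x.
have e01 : 0 <= e <= 1 := class_prob_bounds D x.
have labelE U : label_law D x U = bernoulli_prob e U.
  exact: (@eq_bernoulli R e (label_prob D x) (label_law_true D x)).
rewrite /class_prob /= /kcomp.
rewrite (eq_measure_integral (bernoulli_prob e)); last first.
  by move=> A _ _; exact: labelE.
rewrite integral_bernoulli_prob//=.
rewrite /observed_pos/=.
have /andP[t0 t1] := rho01 true; have /andP[f0 f1] := rho01 false.
rewrite (@bernoulli_probE _ (1 - rho true x)); last first.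
  by rewrite subr_ge0 t1/= lerBlDr lerDl.
rewrite (@bernoulli_probE _ (rho false x)) ?rho01//.
rewrite !diracE.
have -> : (true \in ([set true] : set label)) = true by exact: mem_set.
have -> : (false \in ([set true] : set label)) = false by exact: memNset.
by rewrite !mule1 !mule0 !adde0 -!EFinM -EFinD/= mulrC [X in _ + X]mulrC.
Qed.

Section BCN.
Context d (X : measurableType d) (R : realType).

(* Only the composites f y \o s, i.e. the flip probabilities, have to be
   measurable for the noisy distribution to exist. *)
Definition BCNplus (f : label -> R -> R) (s : X -> R)
    (mfs : forall y, measurable_fun [set: X] (f y \o s))
    (D : labeled_distribution X R) : labeled_distribution X R :=
  ILN mfs D.

Record BCNplus_admissible (f : label -> R -> R) (s eta : X -> R) : Prop := {
  score_order_preserving : forall x x', eta x < eta x' -> s x < s x' ;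
  noise_nondecreasing : forall y x x', s x <= s x' ->
    eta x <= 2^-1 -> eta x' <= 2^-1 -> f y (s x) <= f y (s x') ;
  noise_nonincreasing : forall y x x', s x <= s x' ->
    2^-1 <= eta x -> 2^-1 <= eta x' -> f y (s x') <= f y (s x) ;
  noise_gap_nonincreasing : forall z z', z <= z' ->
    f true z' - f false z' <= f true z - f false z }.

End BCN.

(* Main.v *)
(* Centring at 1/2 gives
     eta_bar - 1/2 = (1 - rho_1 - rho_{-1}) (eta - 1/2) - (rho_1 - rho_{-1}) / 2.
   The last term is non-decreasing in the score.  In the first one, the positive
   factor 1 - rho_1 - rho_{-1} decreases up to eta = 1/2, where it multiplies a
   nonpositive number, and increases after 1/2, where it multiplies a
   nonnegative one; hence the product is strictly increasing in eta. *)
Require Import Defs.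
From mathcomp Require Import all_boot all_order all_algebra.
From mathcomp Require Import all_classical all_reals all_analysis.
From mathcomp Require Import ring lra.

Import Order.TTheory GRing.Theory Num.Theory.
Local Open Scope classical_set_scope.
Local Open Scope ring_scope.

Lemma flipped_prob_lt (R : realFieldType) (a b a' b' p p' : R) :
  a + b < 1 -> a' + b' < 1 -> a' - b' <= a - b -> p < p' ->
  (p' <= 2^-1 -> a <= a' /\ b <= b') ->
  (2^-1 <= p -> a' <= a /\ b' <= b) ->
  (1 - a) * p + b * (1 - p) < (1 - a') * p' + b' * (1 - p').
Proof.
move=> ab1 ab1' gap pp' below above.
have centre (u v q : R) : (1 - u) * q + v * (1 - q) =
    (1 - u - v) * (q - 2^-1) + (1 - (u - v)) / 2 by field.
rewrite !centre ltr_leD//; last by lra.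
have [p'le|p'gt] := leP p' 2^-1.
  have [aa' bb'] := below p'le.
  (* The factor changes first, at the nonpositive [p - 1/2]; above 1/2 it changes last, at
     [p' - 1/2]. *)
  apply: (@le_lt_trans _ _ ((1 - a' - b') * (p - 2^-1))).
    by rewrite ler_wnM2r; lra.
  by rewrite ltr_pM2l; lra.
have [ple|plt] := leP 2^-1 p.
  have [aa' bb'] := above ple.
  apply: (@lt_le_trans _ _ ((1 - a - b) * (p' - 2^-1))).
    by rewrite ltr_pM2l; lra.
  by rewrite ler_wpM2r; lra.
(* Here [p < 1/2 < p'], so the two products have opposite signs. *)
apply: (@lt_trans _ _ 0).
  by rewrite pmulr_rlt0; lra.
by rewrite mulr_gt0; lra.
Qed.

(** Take [phi u] to be the supremum of [g] over the sublevel set [h <= u]. By contraposition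
    [h x' <= h x] gives [g x' <= g x], so at [u = h x] it equals [g x]. *)
Lemma nondecreasing_factorization (T : Type) (R : realType) (g h : T -> R)
    (m M : R) :
  (forall x, m <= g x <= M) ->
  (forall x x', g x < g x' -> h x < h x') ->
  exists phi : R -> R, {homo phi : u v / u <= v} /\ g = phi \o h.
Proof.
move=> gmM gh.
(* Adding m keeps the set nonempty: sup set0 = 0 could break monotonicity. *)
pose A u : set R := m |` g @` [set x | h x <= u].
have A0 u : A u !=set0 by exists m; left.
have supA u : has_sup (A u).
  (* If [T] is empty, [m <= M] may fail, hence the maximum. *)
  split=> //; exists (Num.max m M) => _ [->|[x _ <-]]; rewrite le_max ?lexx//.
  by have /andP[_ ->] := gmM x; rewrite orbT.
exists (sup \o A); split=> [u v uv|].
  apply: ge_sup => // r [->|[x hxu <-]].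
    by apply: sup_upper_bound => //; left.
  by apply: sup_upper_bound => //; right; exists x => //; apply: le_trans uv.
apply/funext => x /=; apply/eqP; rewrite eq_le; apply/andP; split.
  by apply: sup_upper_bound => //; right; exists x => /=.
apply: ge_sup => // r [->|[x' hx' <-]]; first by have /andP[] := gmM x.
by rewrite leNgt; apply: contraTN hx' => /gh; rewrite ltNge.
Qed.

Theorem proposition7 (d : measure_display) (X : measurableType d)
    (R : realType) (D : labeled_distribution X R)
    (f : label -> R -> R) (s : X -> R)
    (mfs : forall y : label, measurable_fun [set: X] (f y \o s))
    (pi01 : (0 < base_rate D < 1)%E)
    (f01 : forall (y : label) (z : R), 0 <= f y z <= 1)
    (total_noise : forall x : X, f true (s x) + f false (s x) < 1)
    (adm : BCNplus_admissible f s (class_prob D)) :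
  let eta := class_prob D in
  let eta_bar := class_prob (BCNplus mfs D) in
  (forall x x' : X, eta x < eta x' -> eta_bar x < eta_bar x') /\
  (exists phi : R -> R,
     {homo phi : u v / u <= v} /\ eta = phi \o eta_bar).
Proof.
move=> eta eta_bar.
have mono x x' : eta x < eta x' -> eta_bar x < eta_bar x'.
  move=> lt_eta; have le_s := ltW (score_order_preserving adm lt_eta).
  rewrite /eta_bar /BCNplus !class_prob_ILN /=; try by move=> y; exact: f01.
  apply: flipped_prob_lt => //.
  - exact: (noise_gap_nonincreasing adm).
  - move=> le_half; have le_half' := le_trans (ltW lt_eta) le_half.
    by split; apply: (noise_nondecreasing adm).
  - move=> ge_half; have ge_half' := le_trans ge_half (ltW lt_eta).
    by split; apply: (noise_nonincreasing adm).
split=> //.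
(* The bounds on [eta] are 0 and 1. *)
by apply: nondecreasing_factorization mono; exact: class_prob_bounds.
Qed.
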